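(* Let $\Bbbk$ be a field of characteristic $0$, let $d\ge 1$, and let $\Delta$ be a $d$-dimensional pseudomanifold on $n$ vertices. Let $A=A(\Delta)=\Bbbk[x_1,\ldots,x_n]/\langle x_1^2,\ldots,x_n^2,I_\Delta\rangle$, where $I_\Delta$ is the Stanley-Reisner ideal of $\Delta$. Then the Weak Lefschetz Property (WLP) holds for $A$ in degree $d$ if and only if (i) $\Delta$ has boundary, or (ii) $\Delta$ has no boundary and the dual graph of $\Delta$ is not bipartite.
   Context: A simplicial complex $\Delta$ on a finite non-empty vertex set $V=\{1,\ldots,n\}$ is a non-empty collection of subsets (faces) of $V$ closed under taking subsets; a face with $k+1$ elements is a $k$-face or $k$-simplex; facets are the inclusion-maximal faces. The Stanley-Reisner ideal is $I_\Delta=\langle x_{i_1}\cdots x_{i_m} : \{i_1,\ldots,i_m\}\notin\Delta\rangle$. The algebra $A(\Delta)$ is standard graded Artinian; $A_i$ is its degree-$i$ component. WLP holds for $A$ in degree $i$ if, for a general linear form $\ell$, the multiplication map $\times\ell: A_i\to A_{i+1}$ is injective or surjective. For $d\ge1$, a $d$-dimensional pseudomanifold is a simplicial complex such that: each facet is a $d$-simplex; every $(d-1)$-simplex is a face of at least one and at most two $d$-simplices; and given any two $d$-simplices $F_1,F_k$ there is a chain of $d$-simplices $F_1,F_2,\ldots,F_k$ such that $F_i\cap F_{i+1}$ is a $(d-1)$-simplex for $1\le i\le k-1$. It has boundary if some $(d-1)$-simplex is a face of exactly one $d$-simplex; otherwise it is without boundary (has no boundary). The dual graph of $\Delta$ is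 the graph whose vertices are the facets of $\Delta$, two of them being adjacent if and only if the facets share a $(d-1)$-face. *)

(* Defs.v *)
From HB Require Import structures.
From mathcomp Require Import all_boot all_order all_algebra.
From mathcomp Require Import ring_quotient boolp.
From mathcomp Require Import mpoly.

Set Implicit Arguments.
Unset Strict Implicit.
Unset Printing Implicit Defensive.

Import GRing.Theory.

Local Open Scope ring_scope.
Local Open Scope quotient_scope.

(* Not every vertex is required to be a face. *)
Record simplicial_complex (n : nat) := SimplicialComplex {
  faces :> {set {set 'I_n}};
  vertices_nonempty : (0 < n)%N;
  faces_nonempty : faces != set0;
  faces_closed : forall F G : {set 'I_n},
    F \in faces -> G \subset F -> G \in faces
}.

Section Pseudomanifolds.
Variables (n : nat) (Delta : simplicial_complex n).
Implicit Types F G : {set 'I_n}.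

Definition simplices (k : nat) : {set {set 'I_n}} :=
  [set F in faces Delta | #|F| == k.+1].

Definition facets : {set {set 'I_n}} :=
  [set F | maxset (fun G => G \in faces Delta) F].

Definition cofaces (d : nat) G : {set {set 'I_n}} :=
  [set F in simplices d | G \subset F].

(* d.-1 is the intended d - 1 only for d >= 1, which pseudomanifold imposes. *)
Definition ridge_adjacent (d : nat) : rel {set 'I_n} :=
  fun F G => F :&: G \in simplices d.-1.

Definition has_boundary (d : nat) : Prop :=
  exists2 G, G \in simplices d.-1 & #|cofaces d G| = 1%N.

Definition pseudomanifold (d : nat) : Prop :=
  [/\ (0 < d)%N,
      forall F, F \in facets -> F \in simplices d,
      forall G, G \in simplices d.-1 -> (1 <= #|cofaces d G| <= 2)%N
    & forall F G, F \in simplices d -> G \in simplices d ->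
        exists s : seq {set 'I_n},
          [/\ all (fun H => H \in simplices d) s,
              path (ridge_adjacent d) F s
            & last F s = G] ].

(* Adjacency in the dual graph, whose vertex set is facets. *)
Definition dual_edge (d : nat) : rel {set 'I_n} :=
  fun F G => [&& F \in facets, G \in facets, F != G
    & [exists H, [&& H \in simplices d.-1, H \subset F & H \subset G]]].

End Pseudomanifolds.

Definition bipartite (T : finType) (V : {set T}) (e : rel T) : Prop :=
  exists P Q : {set T},
    [/\ P :|: Q = V, [disjoint P & Q]
      & forall x y, x \in V -> y \in V -> e x y ->
          (x \in P /\ y \in Q) \/ (x \in Q /\ y \in P)].

Definition ideal_gen (R : comNzRingType) (S : R -> Prop) (f : R) : Prop :=
  exists s : seq (R * R),
    (forall u, u \in s -> S u.2) /\ f = \sum_(u <- s) u.1 * u.2.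

Section Algebra.
Variables (K : fieldType) (n : nat) (Delta : simplicial_complex n).

Definition stanley_reisner_ideal : {mpoly K[n]} -> Prop :=
  ideal_gen (fun f => exists2 F : {set 'I_n},
    F \notin faces Delta & f = \prod_(i in F) 'X_i).

Definition artinian_ideal : {mpoly K[n]} -> Prop :=
  ideal_gen (fun f =>
    (exists i : 'I_n, f = 'X_i ^+ 2) \/ stanley_reisner_ideal f).

Definition artinian_pred : {pred {mpoly K[n]}} :=
  fun f => `[< artinian_ideal f >].

Lemma ideal_gen_eval0 (S : {mpoly K[n]} -> Prop) f :
  (forall g, S g -> g.@[fun=> 0] = 0) -> ideal_gen S f -> f.@[fun=> 0] = 0.
Proof.
move=> S0 [s [sS ->]]; rewrite raddf_sum /= big_seq big1 // => u us.
by rewrite mevalM (S0 u.2) ?mulr0 //; apply: sS.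
Qed.

Lemma set0_face : set0 \in faces Delta.
Proof.
case/set0Pn: (faces_nonempty Delta) => F FD.
exact: faces_closed FD (sub0set F).
Qed.

Lemma artinian_ideal_eval0 f : artinian_ideal f -> f.@[fun=> 0] = 0.
Proof.
apply: ideal_gen_eval0 => g [[i ->]|]; first by rewrite rmorphXn /= mevalXU expr0n.
apply: ideal_gen_eval0 => h [F FD ->].
have /set0Pn[i iF] : F != set0.
  by apply: contraNneq FD => ->; apply: set0_face.
by rewrite (bigD1 i) //= mevalM mevalXU mul0r.
Qed.

Lemma artinian_idealr_closed : idealr_closed artinian_pred.
Proof.
split.
- by apply/asboolP; exists [::]; rewrite big_nil.
- apply/negP => /asboolP /artinian_ideal_eval0 /eqP.
  by rewrite meval1 oner_eq0.
move=> a u v /asboolP[s [sS ->]] /asboolP[t [tS ->]]; apply/asboolP.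
exists ([seq (a * w.1, w.2) | w <- s] ++ t); split; last first.
  rewrite big_cat big_map /= mulr_sumr; congr (_ + _).
  by apply: eq_bigr => w _; rewrite mulrA.
by move=> w; rewrite mem_cat => /orP[/mapP[x xs ->]|/tS //]; apply: (sS x).
Qed.

HB.instance Definition _ :=
  isIdealr.Build {mpoly K[n]} artinian_pred artinian_idealr_closed.

Definition artinian_algebra : comNzRingType :=
  {ideal_quot artinian_pred}.

Local Notation A := artinian_algebra.

Definition graded_component (i : nat) (a : A) : Prop :=
  exists2 f : {mpoly K[n]}, f \is i.-homog & a = \pi_{ideal_quot artinian_pred} f.

Definition linear_form (c : 'I_n -> K) : A :=
  \pi_{ideal_quot artinian_pred} (\sum_(i < n) c i *: 'X_i).

End Algebra.

Definition zariski_open (K : fieldType) (n : nat) (U : ('I_n -> K) -> Prop) :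
    Prop :=
  exists S : {mpoly K[n]} -> Prop,
    forall c, U c <-> exists2 p, S p & p.@[c] != 0.

(* A property of general points of affine n-space. *)
Definition generally (K : fieldType) (n : nat) (P : ('I_n -> K) -> Prop) :
    Prop :=
  exists U : ('I_n -> K) -> Prop,
    [/\ zariski_open U, exists c, U c & forall c, U c -> P c].

Definition WLP_in_degree (K : fieldType) (n : nat)
    (Delta : simplicial_complex n) (i : nat) : Prop :=
  let A_ := @graded_component K n Delta in
  generally (fun c : 'I_n -> K =>
    let l := linear_form Delta c in
    (forall a b, A_ i a -> A_ i b -> l * a = l * b -> a = b) \/
    (forall b, A_ i.+1 b -> exists2 a, A_ i a & l * a = b)).

(* Main.v *)
(* A polynomial lies in the defining ideal of A iff its coefficients at the
   squarefree monomials x_F, F a face, all vanish.  So A_d and A_(d+1) have the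
   (d-1)-faces ("ridges") and the d-faces as bases, and multiplication by
   l = sum c_i x_i is a weighted incidence matrix.  If all c_i <> 0, rescaling
   the dual vector phi to psi(F) = phi(F) prod_(i in F) c_i turns the equations
   of the dual kernel into "psi sums to 0 over the facets containing a ridge":
   psi changes sign along the dual graph and vanishes next to the boundary, so it
   is 0 if there is a boundary or the dual graph is not bipartite, and then
   multiplication by l is surjective.  Without boundary and with a bipartite dual
   graph, the dual kernel is nonzero for every c, hence l is not surjective; it
   is not injective either, since double counting gives at least as many ridges
   as facets. *)
Require Import Defs.
From mathcomp Require Import all_boot all_order all_algebra.
From mathcomp Require Import ring_quotient boolp mpoly.

Set Implicit Arguments.
Unset Strict Implicit.
Unset Printing Implicit Defensive.

Import GRing.Theory.

(** * Coefficients at squarefree monomials *)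

Section Coefficients.
Local Open Scope ring_scope.
Variables (K : fieldType) (n : nat).
Implicit Types (p f : {mpoly K[n]}) (m k : 'X_{1..n}) (F G : {set 'I_n}).

Lemma mcoeffMX_eq0 p k m : ~~ (k <= m)%MM -> (p * 'X_[k])@_m = 0.
Proof.
move=> Nkm; apply: memN_msupp_eq0; apply: contra Nkm.
rewrite (perm_mem (msuppMX p k)) => /mapP[m' _ ->].
exact: lem_addr.
Qed.

Lemma mesym1_le F G : (mesym1 F <= mesym1 G)%MM = (F \subset G).
Proof.
apply/mnm_lepP/subsetP => [le i iF | sFG i].
  by have := le i; rewrite !mnmE iF lt0b.
by rewrite !mnmE; case: (boolP (i \in F)) => // /sFG ->.
Qed.

Lemma mpolyX_mesym1 F : 'X_[mesym1 F] = \prod_(i in F) 'X_i :> {mpoly K[n]}.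
Proof.
rewrite mpolyXE_id [RHS]big_mkcond; apply: eq_bigr => i _.
by rewrite mnmE; case: (i \in F); rewrite ?expr1 ?expr0.
Qed.

(** The term ['X_i * p] reaches the monomial of [F] only if ['X_i] divides it, that is if [i \in F];
    the cofactor is then the monomial of [F :\ i]. *)
Lemma mcoeffM_linear (c : 'I_n -> K) p F :
  ((\sum_(i < n) c i *: 'X_i) * p)@_(mesym1 F)
    = \sum_(i in F) c i * p@_(mesym1 (F :\ i)).
Proof.
rewrite mulr_suml raddf_sum [RHS]big_mkcond /=; apply: eq_bigr => i _.
rewrite -scalerAl mcoeffZ mulrC [_ * p]mulrC; case: ifPn => iF.
  have -> : mesym1 F = (U_(i) + mesym1 (F :\ i))%MM.
    apply/mnmP => j; rewrite !mnmE !inE [j == i]eq_sym.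
    by case: eqVneq => [<-|]; rewrite ?iF.
  by rewrite mcoeffMX mulrC.
by rewrite mcoeffMX_eq0 ?mul0r // -mesym1_set1 mesym1_le sub1set.
Qed.

End Coefficients.

(** * Equality in the quotient, read off from coefficients at faces *)

Section QuotientAlgebra.
Local Open Scope ring_scope.
Variables (K : fieldType) (n : nat) (Delta : simplicial_complex n).
Implicit Types (p q f g : {mpoly K[n]}) (F G : {set 'I_n}).

(** Squares and nonface monomials do not divide the monomial of a face, because faces are closed
    under subsets. Conversely, each monomial of [f] is divisible by a square, or is squarefree with
    a nonface as support, or is the monomial of a face and has coefficient 0. *)
Lemma artinian_ideal_coefP f :
  artinian_ideal Delta f <-> {in Delta, forall F, f@_(mesym1 F) = 0}.
Proof.
split=> [[s [sS ->]] F FD | f0].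
  rewrite raddf_sum /= big_seq big1 // => u /sS[[i ->]|[t [tS ->]]].
    rewrite mpolyXn mcoeffMX_eq0 //; apply/negP => /mnm_lepP/(_ i).
    by rewrite mulmnE !mnmE eqxx; case: (i \in F).
  rewrite mulr_sumr raddf_sum /= big_seq big1 // => v /tS[G GD ->].
  rewrite mulrA -mpolyX_mesym1 mcoeffMX_eq0 // mesym1_le.
  by apply: contra GD; exact: faces_closed FD.
have idM p q : artinian_ideal Delta q -> artinian_ideal Delta (p * q).
  case=> s [sS ->]; exists [seq (p * u.1, u.2) | u <- s]; split.
    by move=> _ /mapP[u us ->]; apply: (sS u).
  by rewrite big_map mulr_sumr; apply: eq_bigr => u _; rewrite mulrA.
have idS q :
    (exists i : 'I_n, q = 'X_i ^+ 2) \/ stanley_reisner_ideal Delta q ->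
  artinian_ideal Delta q.
  move=> Sq; exists [:: (1, q)]; split; last by rewrite big_seq1 mul1r.
  by move=> u; rewrite inE => /eqP ->.
rewrite (mpolyE f) big_seq.
apply: big_ind => [|p q [s [sS ->]] [t [tS ->]]|m _].
- by exists [::]; rewrite big_nil.
- exists (s ++ t); rewrite big_cat; split=> // u.
  by rewrite mem_cat => /orP[/sS|/tS].
have [/existsP[i m_i] | /existsPn m_le1] := boolP [exists i, 1 < m i]%N.
  have -> : m = ((m - U_(i) *+ 2) + U_(i) *+ 2)%MM.
    rewrite submK //; apply/mnm_lepP => j; rewrite mulmnE mnmE.
    by case: eqVneq => [<-|].
  rewrite mpolyXD scalerAl; apply/idM/idS; left; exists i.
  by rewrite mpolyXn.
have -> : m = mesym1 [set i | 0 < m i]%N.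
  apply/mnmP => i; rewrite mnmE inE; have := m_le1 i.
  by case: (m i) => [|[|]].
have [FD|FD] := boolP ([set i | 0 < m i]%N \in Delta).
  by rewrite f0 // scale0r; exists [::]; rewrite big_nil.
rewrite -mul_mpolyC; apply/idM/idS; right.
exists [:: (1, 'X_[mesym1 [set i | 0 < m i]%N])]; split; last first.
  by rewrite big_seq1 mul1r.
by move=> u; rewrite inE => /eqP -> /=; exists [set i | 0 < m i]%N;
  rewrite ?mpolyX_mesym1.
Qed.

Lemma artinian_pi_eqP f g :
  \pi_{ideal_quot artinian_pred (K := K) Delta}%qT f
    = \pi_{ideal_quot artinian_pred (K := K) Delta}%qT g <->
  {in Delta, forall F, f@_(mesym1 F) = g@_(mesym1 F)}.
Proof.
have -> : (\pi_{ideal_quot artinian_pred (K := K) Delta}%qT f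
    = \pi_{ideal_quot artinian_pred (K := K) Delta}%qT g) <->
    artinian_ideal Delta (f - g).
  split=> [/eqP|Ifg].
    by rewrite -Quotient.idealrBE => /asboolP.
  by apply/eqP; rewrite -Quotient.idealrBE; apply/asboolP.
rewrite artinian_ideal_coefP; split=> fg F /fg.
  by rewrite mcoeffB => /eqP; rewrite subr_eq0 => /eqP.
by rewrite mcoeffB => ->; rewrite subrr.
Qed.

End QuotientAlgebra.

(** * Duality for linear systems indexed by finite sets *)

Section FiniteLinearSystems.
Local Open Scope ring_scope.
Variables (K : fieldType) (T : finType) (A B : {set T}) (w : T -> T -> K).

Let M := \matrix_(i < #|A|, j < #|B|) w (enum_val i) (enum_val j).

(** As [enum_val] is injective, the sum has at most one term: a vector indexed by ordinals becomes a
    function on [T], zero outside [S]. *)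
Let extend (S : {set T}) (u : 'I_#|S| -> K) x := \sum_(i | enum_val i == x) u i.

Let extendE (S : {set T}) (u : 'I_#|S| -> K) i : extend u (enum_val i) = u i.
Proof. by apply: big_pred1 => j; apply/eqP/eqP => [/enum_val_inj|->]. Qed.

Lemma solvable_of_dual_kernel0 :
  (forall phi : T -> K,
     {in A, forall x, \sum_(y in B) w x y * phi y = 0} ->
     {in B, forall y, phi y = 0}) ->
  forall b : T -> K, exists a : T -> K,
    {in B, forall y, \sum_(x in A) w x y * a x = b y}.
Proof.
move=> ker0 b.
have /row_fullP[N NM] : row_full M.
  rewrite -cokermx_eq0; apply/eqP/matrixP => y j; rewrite [RHS]mxE.
  (* Each column of [cokermx M], extended to [T], is a dual kernel vector, hence zero. *)
  rewrite -(extendE (fun y => cokermx M y j) y).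
  apply: ker0 (enum_valP y) => x xA.
  have /matrixP/(_ (enum_rank_in xA x) j) := mulmx_coker M.
  rewrite mxE [RHS]mxE => Mk; rewrite -[RHS]Mk [LHS]big_enum_val; apply: eq_bigr => k _.
  by rewrite extendE [M _ _]mxE enum_rankK_in.
(* The solution is [b *m N], where [N] is a left inverse of [M]. *)
exists (extend (fun i => ((\row_j b (enum_val j)) *m N) 0 i)) => y yB.
have /rowP/(_ (enum_rank_in yB y)) :
    \row_j b (enum_val j) *m N *m M = \row_j b (enum_val j).
  by rewrite -mulmxA NM mulmx1.
rewrite [LHS]mxE [RHS]mxE enum_rankK_in // => <-.
rewrite big_enum_val; apply: eq_bigr => i _.
by rewrite extendE [M _ _]mxE enum_rankK_in // mulrC.
Qed.

(** The dual kernel vector forces the rank of [M] below [#|B|], hence below the number [#|A|] of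
    rows, so the rows are dependent. *)
Lemma kernel_of_dual_kernel (phi : T -> K) :
  (#|B| <= #|A|)%N ->
  {in A, forall x, \sum_(y in B) w x y * phi y = 0} ->
  (exists2 y, y \in B & phi y != 0) ->
  exists a : T -> K,
    {in B, forall y, \sum_(x in A) w x y * a x = 0} /\
    exists2 x, x \in A & a x != 0.
Proof.
move=> leBA phi_ker [y yB phi_y].
have NfullM : ~~ row_full M.
  apply: contra phi_y => /row_fullP[N NM].
  have: N *m (M *m \col_j phi (enum_val j)) = \col_j phi (enum_val j).
    by rewrite mulmxA NM mul1mx.
  have -> : M *m \col_j phi (enum_val j) = 0.
    apply/colP => i; rewrite !mxE -[RHS](phi_ker _ (enum_valP i)) [RHS]big_enum_val.
    by apply: eq_bigr => j _; rewrite !mxE.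
  rewrite mulmx0 => /colP/(_ (enum_rank_in yB y)).
  by rewrite !mxE enum_rankK_in // => <-.
have: kermx M != 0.
  rewrite kermx_eq0; apply: contra NfullM => /eqP rM.
  by rewrite /row_full eqn_leq rank_leq_col rM.
case/matrix0Pn => k [i ki0].
exists (extend (fun i => kermx M k i)); split=> [z zB|]; last first.
  by exists (enum_val i); rewrite ?enum_valP ?extendE.
have /matrixP/(_ k (enum_rank_in zB z)) := mulmx_ker M.
rewrite mxE [RHS]mxE => Mk; rewrite -[RHS]Mk [LHS]big_enum_val; apply: eq_bigr => j _.
by rewrite extendE [M _ _]mxE enum_rankK_in // mulrC.
Qed.

(** Pairing [phi] with any vector in the image gives 0, whereas pairing it with the indicator of [y]
    gives [phi y]. *)
Lemma unsolvable_of_dual_kernel (phi : T -> K) :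
  {in A, forall x, \sum_(y in B) w x y * phi y = 0} ->
  (exists2 y, y \in B & phi y != 0) ->
  exists b : T -> K, forall a : T -> K,
    ~ {in B, forall y, \sum_(x in A) w x y * a x = b y}.
Proof.
move=> phi_ker [y yB phi_y]; exists (fun z => (z == y)%:R) => a ab.
suff: \sum_(z in B) phi z * (z == y)%:R = 0.
  rewrite (bigD1 y) //= eqxx mulr1 big1 ?addr0 => [/eqP|z /andP[_ /negPf->]].
    by apply/negP.
  by rewrite mulr0.
under eq_bigr => z zB do rewrite -ab // mulr_sumr.
rewrite exchange_big big1 //= => x xA.
transitivity ((\sum_(z in B) w x z * phi z) * a x); last first.
  by rewrite phi_ker ?mul0r.
rewrite mulr_suml.
by apply: eq_bigr => z _; rewrite mulrA [phi z * _]mulrC.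
Qed.

End FiniteLinearSystems.

(** * Multiplication by a linear form as a weighted incidence matrix *)

Section Translation.
Local Open Scope ring_scope.
Variables (K : fieldType) (n d : nat) (Delta : simplicial_complex n).
Hypothesis d_gt0 : (0 < d)%N.
Implicit Types (f g : {mpoly K[n]}) (F G : {set 'I_n}) (c : 'I_n -> K).

Let pi_A f : artinian_algebra K Delta :=
  \pi_{ideal_quot artinian_pred (K := K) Delta}%qT f.

Lemma linear_form_mul_eqP c f g :
  linear_form Delta c * pi_A f = pi_A g <->
  {in Delta, forall F, \sum_(i in F) c i * f@_(mesym1 (F :\ i)) = g@_(mesym1 F)}.
Proof.
have -> : linear_form Delta c * pi_A f = pi_A ((\sum_(i < n) c i *: 'X_i) * f).
  by rewrite /pi_A rmorphM.
rewrite artinian_pi_eqP.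
by split=> fg F /fg; rewrite mcoeffM_linear.
Qed.

(** A [k]-simplex has [k.+1] vertices, so this has degree [k.+1]: degree [d] corresponds to
    [d.-1]-simplices. *)
Definition simplex_poly k (a : {set 'I_n} -> K) : {mpoly K[n]} :=
  \sum_(F in simplices Delta k) a F *: 'X_[mesym1 F].

Lemma mcoeff_simplex_poly k a G :
  (simplex_poly k a)@_(mesym1 G) = if G \in simplices Delta k then a G else 0.
Proof.
rewrite raddf_sum /=; case: ifPn => [Gk|NGk].
  rewrite (bigD1 G) //= mcoeffZ mcoeffX eqxx mulr1 big1 ?addr0 // => F.
  by case/andP=> _ /negPf FG; rewrite mcoeffZ mcoeffX (inj_eq (@inj_mesym1 n)) FG mulr0.
rewrite big1 // => F Fk; rewrite mcoeffZ mcoeffX (inj_eq (@inj_mesym1 n)).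
by case: eqP Fk NGk => [-> ->|]; rewrite ?mulr0.
Qed.

Lemma simplex_poly_homog k a : simplex_poly k a \is k.+1.-homog.
Proof.
apply: rpred_sum => F; rewrite inE => /andP[_ /eqP Fk].
by apply: dhomogZ; rewrite dhomogX /= mdeg_mesym1 Fk.
Qed.

Lemma simplicesD1 F i : F \in simplices Delta d -> i \in F ->
  F :\ i \in simplices Delta d.-1.
Proof.
rewrite !inE => /andP[FD /eqP Fd] iF; rewrite (faces_closed FD) ?subD1set //=.
by have := cardsD1 i F; rewrite iF Fd prednK // add1n => -[<-].
Qed.

(** At most one term: [c i] if [F] is [i |: G] with [i \notin G], and 0 if there is no such [i]. The
    form as a sum lets summations be exchanged. *)
Definition incidence c G F := \sum_(i in F | F :\ i == G) c i.

Lemma sum_incidence c (a : {set 'I_n} -> K) F : F \in simplices Delta d ->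
  \sum_(G in simplices Delta d.-1) incidence c G F * a G
    = \sum_(i in F) c i * a (F :\ i).
Proof.
move=> Fd; under eq_bigr => G _ do rewrite mulr_suml.
rewrite (exchange_big_dep (mem F)) /= => [|G i _ /andP[] //].
apply: eq_bigr => i iF; rewrite (big_pred1 (F :\ i)) // => G /=.
rewrite iF /= [F :\ i == G]eq_sym; case: eqVneq => [->|]; rewrite ?andbF //.
by rewrite simplicesD1.
Qed.

Lemma incidence_eq0 c G F : ~~ (G \subset F) -> incidence c G F = 0.
Proof.
move=> NGF; apply: big1 => i /andP[_ /eqP FiG].
by rewrite -FiG subD1set in NGF.
Qed.

Lemma sum_incidence_cofaces c (phi : {set 'I_n} -> K) G :
  \sum_(F in simplices Delta d) incidence c G F * phi F
    = \sum_(F in cofaces Delta d G) incidence c G F * phi F.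
Proof.
rewrite (big_setID (cofaces Delta d G)) /= addrC big1 => [|F].
  rewrite add0r; apply: eq_bigl => F.
  by rewrite [F \in _ :&: _]inE [F \in cofaces _ _ _]inE andbA andbb.
rewrite [F \in _ :\: _]inE [F \in cofaces _ _ _]inE.
case: (F \in simplices Delta d); rewrite ?andbF //= andbT => NGF.
by rewrite incidence_eq0 ?mul0r.
Qed.

Lemma incidence_coface c G F :
  G \in simplices Delta d.-1 -> F \in cofaces Delta d G ->
  exists2 i, i \notin G & F = i |: G /\ incidence c G F = c i.
Proof.
rewrite !inE prednK // => /andP[_ /eqP Gd] /andP[/andP[_ /eqP Fd] GF].
have /cards1P[i FGi] : #|F :\: G| == 1%N.
  by rewrite cardsDS // Fd Gd subSnn.
have /setDP[iF iG] : i \in F :\: G by rewrite FGi set11.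
have FE : F = i |: G by rewrite -FGi setUC -[LHS](setID F G) (setIidPr GF).
exists i => //; split=> //; apply: big_pred1 => j /=; apply/idP/eqP => [|->].
  case/andP=> jF /eqP FjG; apply/set1P; rewrite -FGi inE jF andbT.
  by rewrite -FjG setD11.
by rewrite iF {1}FE setU1K ?eqxx.
Qed.

Let A_ := @graded_component K n Delta.

Lemma solvable_of_surjective c (b : {set 'I_n} -> K) :
  (forall y, A_ d.+1 y -> exists2 x, A_ d x & linear_form Delta c * x = y) ->
  exists a : {set 'I_n} -> K, {in simplices Delta d, forall F,
    \sum_(G in simplices Delta d.-1) incidence c G F * a G = b F}.
Proof.
move=> surj; have [|x [f f_homog ->]] := surj (pi_A (simplex_poly d b)).
  by exists (simplex_poly d b); rewrite ?simplex_poly_homog.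
move/linear_form_mul_eqP => fb; exists (fun G => f@_(mesym1 G)) => F Fd.
rewrite sum_incidence // fb ?mcoeff_simplex_poly ?Fd //.
by move: Fd; rewrite inE => /andP[].
Qed.

Lemma surjective_of_solvable c :
  (forall b : {set 'I_n} -> K, exists a : {set 'I_n} -> K,
    {in simplices Delta d, forall F,
    \sum_(G in simplices Delta d.-1) incidence c G F * a G = b F}) ->
  forall y, A_ d.+1 y -> exists2 x, A_ d x & linear_form Delta c * x = y.
Proof.
move=> solv y [g g_homog ->]; have [a a_g] := solv (fun F => g@_(mesym1 F)).
exists (pi_A (simplex_poly d.-1 a)).
  exists (simplex_poly d.-1 a) => //.
  by have := simplex_poly_homog d.-1 a; rewrite prednK.
apply/linear_form_mul_eqP => F FD; have [Fd|Fd] := boolP (F \in simplices Delta d).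
  rewrite -a_g // sum_incidence //; apply: eq_bigr => i iF.
  by rewrite mcoeff_simplex_poly simplicesD1.
(* On faces of another size both sides vanish: [g] is homogeneous of degree [d.+1], and no [F :\ i]
   has [d] elements. *)
have {}Fd : #|F| != d.+1 by move: Fd; rewrite inE FD.
have -> : g@_(mesym1 F) = 0.
  by apply: (dhomog_nemf_coeff g_homog); rewrite /= mdeg_mesym1.
rewrite big1 // => i iF.
rewrite mcoeff_simplex_poly ifN ?mulr0 // inE negb_and prednK //.
by apply/orP; right; apply: contra Fd; rewrite [#|F|](cardsD1 i) iF => /eqP->.
Qed.

Lemma kernel0_of_injective c (a : {set 'I_n} -> K) :
  (forall x y, A_ d x -> A_ d y ->
    linear_form Delta c * x = linear_form Delta c * y -> x = y) ->
  {in simplices Delta d, forall F,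
    \sum_(G in simplices Delta d.-1) incidence c G F * a G = 0} ->
  {in simplices Delta d.-1, forall G, a G = 0}.
Proof.
move=> inj a_ker G Gd.
have homog_a : simplex_poly d.-1 a \is d.-homog.
  by have := simplex_poly_homog d.-1 a; rewrite prednK.
have: pi_A (simplex_poly d.-1 a) = pi_A 0.
  apply: inj; [by exists (simplex_poly d.-1 a) | by exists 0; rewrite ?rpred0 |].
  rewrite [X in _ = _ * X]rmorph0 mulr0 -[0](rmorph0 pi_A).
  apply/linear_form_mul_eqP => F FD; rewrite mcoeff0.
  have [Fd|Fd] := boolP (F \in simplices Delta d).
    rewrite -[RHS](a_ker F) // sum_incidence //; apply: eq_bigr => i iF.
    by rewrite mcoeff_simplex_poly simplicesD1.
  rewrite big1 // => i iF; rewrite mcoeff_simplex_poly ifN ?mulr0 // inE negb_and.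
  by apply/orP; right; apply: contra Fd; rewrite inE FD [#|F|](cardsD1 i) iF prednK.
move/artinian_pi_eqP/(_ G); rewrite mcoeff_simplex_poly Gd mcoeff0; apply.
by move: Gd; rewrite inE => /andP[].
Qed.

End Translation.

(** * Combinatorics of facets and ridges *)

Section Pseudomanifold.
Variables (n d : nat) (Delta : simplicial_complex n).
Hypothesis Delta_pm : pseudomanifold Delta d.
Implicit Types F G H : {set 'I_n}.

Let d_gt0 : 0 < d. Proof. by case: Delta_pm. Qed.

Lemma facets_simplices : facets Delta = simplices Delta d.
Proof.
case: Delta_pm => _ facet_dim _ _; apply/setP => F.
apply/idP/idP => [/facet_dim //|]; rewrite inE => /andP[FD /eqP Fd].
have [G Gmax FG] := maxset_exists (P := fun G => G \in faces Delta) FD.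
suff -> : F = G by rewrite inE.
have : G \in simplices Delta d by apply: facet_dim; rewrite inE.
rewrite inE => /andP[_ /eqP Gd].
by apply/eqP; rewrite eqEcard FG Fd Gd leqnn.
Qed.

Lemma simplices_neq0 : exists F, F \in simplices Delta d.
Proof.
have [F FD] := set0Pn _ (faces_nonempty Delta).
have [G Gmax _] := maxset_exists (P := fun G => G \in faces Delta) FD.
by exists G; rewrite -facets_simplices inE.
Qed.

Lemma cofaces_pair G F H : G \in simplices Delta d.-1 ->
  F \in cofaces Delta d G -> H \in cofaces Delta d G -> F != H ->
  cofaces Delta d G = [set F; H].
Proof.
move=> Gd FG HG FH; case: Delta_pm => _ _ /(_ G Gd)/andP[_ le2] _.
apply/esym/eqP; rewrite eqEcard cards2 FH le2 andbT.
by apply/subsetP => I /set2P[]->.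
Qed.

Lemma no_boundary_cofaces G : ~ has_boundary Delta d ->
  G \in simplices Delta d.-1 ->
  exists F H, F != H /\ cofaces Delta d G = [set F; H].
Proof.
move=> Nbd Gd; apply/cards2P.
case: Delta_pm => _ _ /(_ G Gd)/andP[ge1 le2] _.
rewrite eqn_leq le2 ltn_neqAle ge1 andbT /= eq_sym; apply/eqP => G1.
by apply: Nbd; exists G.
Qed.

Lemma dual_edge_cofaces G F H : G \in simplices Delta d.-1 -> F != H ->
  cofaces Delta d G = [set F; H] -> dual_edge Delta d F H.
Proof.
move=> Gd FH GE.
have : F \in cofaces Delta d G by rewrite GE set21.
have : H \in cofaces Delta d G by rewrite GE set22.
rewrite [F \in _]inE [H \in _]inE => /andP[Hd GH] /andP[Fd GF].
rewrite /dual_edge facets_simplices Fd Hd FH; apply/existsP; exists G.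
by rewrite Gd GF.
Qed.

(** Count incident pairs: each ridge lies in exactly two [d]-simplices, and each [d]-simplex
    contains [d.+1 >= 2] ridges. *)
Lemma card_simplices_le_ridges : ~ has_boundary Delta d ->
  #|simplices Delta d| <= #|simplices Delta d.-1|.
Proof.
move=> Nbd; rewrite -(leq_pmul2r (isT : 0 < 2)) -!sum_nat_const.
have -> : \sum_(G in simplices Delta d.-1) 2 =
    \sum_(G in simplices Delta d.-1) \sum_(F in simplices Delta d | G \subset F) 1.
  apply: eq_bigr => G Gd; have [F [H [FH GE]]] := no_boundary_cofaces Nbd Gd.
  transitivity #|cofaces Delta d G|; first by rewrite GE cards2 FH.
  by rewrite -sum1_card; apply: eq_bigl => I; rewrite inE.
rewrite (exchange_big_dep (mem (simplices Delta d))) /= => [|G F _ /andP[]//].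
apply: leq_sum => F Fd; rewrite sum1_card.
apply: (@leq_trans #|[set F :\ i | i in F]|).
  rewrite card_in_imset => [|i j iF jF FiFj].
    by move: Fd; rewrite inE => /andP[_ /eqP ->].
  apply/eqP; apply: contraFT (setD11 j F) => ij.
  by rewrite -FiFj !inE eq_sym ij jF.
apply/subset_leq_card/subsetP => G /imsetP[i iF ->].
by rewrite unfold_in /= simplicesD1 // Fd subD1set.
Qed.

(** * Functions on facets summing to zero around every ridge *)

Section Alternating.
Local Open Scope ring_scope.
Variables (K : fieldType) (psi : {set 'I_n} -> K).
Hypothesis char2 : 2%:R != 0 :> K.
Hypothesis psi_ridge :
  {in simplices Delta d.-1, forall G, \sum_(F in cofaces Delta d G) psi F = 0}.

Lemma alternating_cofaces G F H : G \in simplices Delta d.-1 ->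
  F \in cofaces Delta d G -> H \in cofaces Delta d G -> F != H ->
  psi H = - psi F.
Proof.
move=> Gd FG HG FH; have := psi_ridge Gd.
rewrite (cofaces_pair Gd FG HG FH) big_setU1 ?inE //= big_set1 addrC.
by move/eqP; rewrite addr_eq0 => /eqP.
Qed.

(** Along a chain of simplices from [F] to [H], the value changes sign at each shared ridge. *)
Lemma alternating_up_to_sign F H :
  F \in simplices Delta d -> H \in simplices Delta d ->
  psi H = psi F \/ psi H = - psi F.
Proof.
move=> Fd Hd; case: Delta_pm => _ _ _ /(_ F H Fd Hd)[s [sd sp <-]] {H Hd}.
elim: s F Fd sd sp => [|H s IHs] F Fd /=; first by left.
case/andP=> Hd sd /andP[FH sp].
have -> : psi F = - psi H.
  apply: (alternating_cofaces FH); rewrite ?[_ \in cofaces _ _ _]inE.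
  - by rewrite Hd subsetIr.
  - by rewrite Fd subsetIl.
  (* Adjacent simplices are distinct: their intersection has [d] elements, each of them has
     [d.+1]. *)
  apply/eqP => HF; move: FH Fd; rewrite /ridge_adjacent HF setIid !inE.
  by rewrite prednK // => /andP[_ /eqP->] /andP[_ /eqP/n_Sn].
by rewrite opprK or_comm; apply: IHs.
Qed.

(** At a boundary ridge the sum has one term, so [psi] vanishes there and, up to sign, everywhere.
    In the other case, a nonzero value would make the level sets of [psi F0] and [- psi F0] a
    bipartition. *)
Lemma alternating_eq0 :
  has_boundary Delta d \/ ~ bipartite (facets Delta) (dual_edge Delta d) ->
  {in simplices Delta d, forall F, psi F = 0}.
Proof.
have [F0 F0d] := simplices_neq0.
case=> [[G Gd /eqP/cards1P[F GE]]|Nbip].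
  have psiF0 : psi F = 0 by have := psi_ridge Gd; rewrite GE big_set1.
  have Fd : F \in simplices Delta d.
    have: F \in cofaces Delta d G by rewrite GE set11.
    by rewrite inE => /andP[].
  by move=> H Hd; case: (alternating_up_to_sign Fd Hd) => ->;
    rewrite psiF0 ?oppr0.
suff psiF0 : psi F0 = 0.
  by move=> H Hd; case: (alternating_up_to_sign F0d Hd) => ->;
    rewrite psiF0 ?oppr0.
apply/eqP; apply: contra_notT Nbip => psi_neq0.
(* [char2] keeps the two level sets disjoint. *)
have NpsiF0 : - psi F0 != psi F0.
  by rewrite eq_sym -subr_eq0 opprK -mulr2n -mulr_natl mulf_neq0.
pose level x := [set F in simplices Delta d | psi F == x].
have levelE F x : (F \in level x) = (F \in simplices Delta d) && (psi F == x).
  by rewrite in_set.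
exists (level (psi F0)), (level (- psi F0)); rewrite facets_simplices; split.
- apply/setP => F; rewrite in_setU !levelE -andb_orr.
  have [Fd|//] := boolP (F \in simplices Delta d).
  by case: (alternating_up_to_sign F0d Fd) => ->; rewrite eqxx ?orbT.
- rewrite -setI_eq0; apply/eqP/setP => F; rewrite in_setI !levelE in_set0.
  apply/negP => /andP[/andP[_ /eqP->] /andP[_]].
  by rewrite eq_sym (negPf NpsiF0).
move=> F H Fd Hd /and4P[_ _ FH /existsP[G /and3P[Gd GF GH]]].
rewrite !levelE Fd Hd.
have -> : psi H = - psi F.
  by apply: alternating_cofaces Gd _ _ FH; rewrite inE ?Fd ?Hd.
case: (alternating_up_to_sign F0d Fd) => ->; [left|right];
  by rewrite ?opprK !eqxx.
Qed.

End Alternating.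

(** * The kernel of the transposed incidence matrix *)

Section DualKernel.
Local Open Scope ring_scope.
Variables (K : fieldType) (c : 'I_n -> K).

Let Z := [set i | c i == 0].

Lemma weighted_dual_kernel_eq0 (phi : {set 'I_n} -> K) :
  2%:R != 0 :> K -> (forall i, c i != 0) ->
  has_boundary Delta d \/ ~ bipartite (facets Delta) (dual_edge Delta d) ->
  {in simplices Delta d.-1, forall G,
    \sum_(F in simplices Delta d) incidence c G F * phi F = 0} ->
  {in simplices Delta d, forall F, phi F = 0}.
Proof.
move=> char2 c_neq0 bd_Nbip phi_ker F Fd.
have prod_neq0 (I : {set 'I_n}) : \prod_(i in I) c i != 0.
  by apply/prodf_neq0 => i _.
apply/eqP; rewrite -(mulrI_eq0 _ (mulfI (prod_neq0 F))); apply/eqP.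
apply: (@alternating_eq0 _ (fun I => (\prod_(i in I) c i) * phi I)) Fd => // G Gd.
(* A coface [i |: G] has incidence [c i], which is exactly the factor by which its product exceeds
   that of [G]. *)
transitivity ((\prod_(i in G) c i) *
    \sum_(I in simplices Delta d) incidence c G I * phi I); last first.
  by rewrite phi_ker ?mulr0.
rewrite sum_incidence_cofaces mulr_sumr; apply: eq_bigr => I IG.
have [i iG [-> ->]] := incidence_coface d_gt0 c Gd IG.
by rewrite big_setU1 //= mulrA [c i * _]mulrC.
Qed.

(* For c without zeros, the dual kernel is spanned by the signs of the
   bipartition times prod_(i notin F) c_i.  For general c, with zero set Z, the
   lowest-order term of this vector under c_i := t (i in Z), t -> 0, survives:
   it lives on the facets F minimizing |Z \ F|. *)
Lemma exists_dual_kernel :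
  ~ has_boundary Delta d -> bipartite (facets Delta) (dual_edge Delta d) ->
  exists phi : {set 'I_n} -> K,
    {in simplices Delta d.-1, forall G,
      \sum_(F in simplices Delta d) incidence c G F * phi F = 0} /\
    exists2 F, F \in simplices Delta d & phi F != 0.
Proof.
move=> Nbd [P [Q [PQ PQ0 bip]]].
have [F0 F0d] := simplices_neq0.
have [Fm Fmd Fm_min] := arg_minnP (fun F => #|Z :\: F|) F0d.
pose weight F : K :=
  if #|Z :\: F| == #|Z :\: Fm| then \prod_(i in ~: (F :|: Z)) c i else 0.
(* The product depends on [G] alone, so opposite signs on the two cofaces of [G] cancel. *)
have weight_coface G F : G \in simplices Delta d.-1 -> F \in cofaces Delta d G ->
    incidence c G F * weight F = weight G.
  move=> Gd FG; have Fd : F \in simplices Delta d by move: FG; rewrite inE => /andP[].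
  have := Fm_min F Fd.
  have [i iG [-> ->]] := incidence_coface d_gt0 c Gd FG.
  rewrite /weight; have [ci0|ci] := eqVneq (c i) 0.
    (* Here [Z :\: G] has one element more than [Z :\: F], so it exceeds the minimum and [weight G]
       is 0 too. *)
    have iZ : i \in Z by rewrite inE ci0.
    rewrite ci0 mul0r (cardsD1 i (Z :\: G)) inE iG iZ setDDl [G :|: _]setUC.
    by move=> min_i; rewrite ifN // add1n neq_ltn ltnS min_i orbT.
  have iZ : i \notin Z by rewrite inE.
  have -> : Z :\: (i |: G) = Z :\: G.
    apply/setP => j; rewrite !in_setD in_setU1 negb_or.
    by case: eqVneq => [->|]; rewrite ?(negPf iZ) ?andbF.
  move=> _; case: ifP => _; last by rewrite mulr0.
  rewrite [RHS](bigD1 i) /=; last by rewrite !inE negb_or iG; rewrite inE in iZ.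
  congr (_ * _); apply: eq_bigl => j; rewrite !inE !negb_or.
  by rewrite -andbA andbC -!andbA; do !bool_congr.
exists (fun F => (if F \in P then 1 else -1) * weight F); split=> [G Gd|].
  have [F [H [FH GE]]] := no_boundary_cofaces Nbd Gd.
  have FG : F \in cofaces Delta d G by rewrite GE set21.
  have HG : H \in cofaces Delta d G by rewrite GE set22.
  rewrite sum_incidence_cofaces GE big_setU1 ?inE //= big_set1.
  rewrite 2!(mulrCA (incidence _ _ _)) !weight_coface // -mulrDl.
  have FHe := dual_edge_cofaces Gd FH GE.
  have [Ff Hf] : F \in facets Delta /\ H \in facets Delta by case/and4P: FHe.
  case: (bip _ _ Ff Hf FHe) => [[FP HQ]|[FQ HP]].
    by rewrite FP (disjointFl PQ0 HQ) subrr mul0r.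
  by rewrite HP (disjointFl PQ0 FQ) addNr mul0r.
exists Fm => //; rewrite /weight eqxx mulf_neq0 //.
  by case: ifP; rewrite ?oppr_eq0 oner_eq0.
by apply/prodf_neq0 => i; rewrite !inE negb_or => /andP[].
Qed.

End DualKernel.

End Pseudomanifold.

(** * From generic linear forms to the equivalence *)

Theorem theorem1p2 (K : fieldType) (n d : nat)
    (Delta : simplicial_complex n)
    (charK : [pchar K]%R =i pred0)
    (d_ge1 : 1 <= d)
    (Delta_pm : pseudomanifold Delta d) :
  WLP_in_degree K Delta d <->
  (has_boundary Delta d \/
   (~ has_boundary Delta d /\ ~ bipartite (facets Delta) (dual_edge Delta d))).
Proof.
have char2 : (2%:R != 0 :> K)%R by have := charK 2; rewrite !inE /= => ->.
(* One point [c] of the nonempty open set suffices, since a dual kernel vector exists for every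
   [c]. *)
split=> [[U [_ [c Uc] /(_ c Uc) wlp]] | bd_Nbip].
  have [?|Nbd] := pselect (has_boundary Delta d); [by left | right; split=> // bip].
  have [phi [phi_ker phi_neq0]] := exists_dual_kernel Delta_pm c Nbd bip.
  case: wlp => [inj|surj].
    have [a [a_ker [G Gd /eqP]]] := kernel_of_dual_kernel
      (card_simplices_le_ridges Delta_pm Nbd) phi_ker phi_neq0.
    by apply; apply: kernel0_of_injective inj a_ker G Gd.
  have [b b_unsolvable] := unsolvable_of_dual_kernel phi_ker phi_neq0.
  by have [a /b_unsolvable] := solvable_of_surjective d_ge1 b surj.
(* The locus [p != 0] consists of the points with all coordinates nonzero; it contains the all-ones
   point. *)
pose p : {mpoly K[n]} := (\prod_(i < n) 'X_i)%R.
have pE c : (p.@[c] = \prod_(i < n) c i)%R.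
  by rewrite rmorph_prod /=; apply: eq_bigr => i _; rewrite mevalXU.
exists (fun c => p.@[c] != 0)%R; split=> [||c].
- exists (eq p) => c; split=> [pc|[_ <-] //]; by exists p.
- by exists (fun=> 1%R); rewrite pE big1 // oner_neq0.
rewrite pE => /prodf_neq0 c_neq0; right; apply: surjective_of_solvable => //.
apply: solvable_of_dual_kernel0 => phi.
apply: weighted_dual_kernel_eq0 => // [i|]; first exact: c_neq0.
by case: bd_Nbip => [|[]]; [left|right].
Qed.
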